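(* Let $G$ be a digraph such that $d_u^+(G)>0$ for each $u\in V(G)$, and let $\varepsilon=\{Q_1,\ldots,Q_r\}$ be a biclique partition of $G$. Let $\Theta(\varepsilon)$ be the weighted biclique digraph of $\varepsilon$ defined in the context. (1) For any $u\in V(G)$, $$\kappa_u(G)=\frac{\prod_{v\in V(G),\,v\neq u}d_v^+(G)}{\prod_{j=1}^r|Q_j^{(2)}|}\sum_{i:\,u\in Q_i^{(2)}}t_{Q_i}(\Theta(\varepsilon)).$$ (2) For any $Q_i\in\varepsilon$, $$t_{Q_i}(\Theta(\varepsilon))=\frac{\prod_{j=1}^r|Q_j^{(2)}|}{\prod_{u\in V(G)}d_u^+(G)}\sum_{u\in Q_i^{(1)}}\kappa_u(G).$$
   Context: A digraph $G$ has a finite vertex set $V(G)$ and an edge set $E(G)$ of ordered pairs; $ij\in E(G)$ means there is a directed edge from tail $i$ to head $j$. $d_u^+(G)$ denotes the outdegree of $u$. An oriented spanning tree of a (weighted) digraph $G$ with root $u$ is a subtree containing all vertices of $G$ in which $u$ has outdegree $0$ and every other vertex has outdegree $1$ (all edges point towards the root). $\mathbb{T}_u(G)$ is the set of oriented spanning trees of $G$ with root $u$, $\kappa_u(G)=|\mathbb{T}_u(G)|$, and for a weighted digraph with edge weights $w_e(G)$, $t_u(G)=\sum_{T\in\mathbb{T}_u(G)}\prod_{e\in E(T)}w_e(G)$. A biclique is a bipartite digraph $Q$ whose vertices are partitioned into two (nonempty, disjoint) parts $Q^{(1)},Q^{(2)}$ with $E(Q)=\{ij:i\in Q^{(1)},j\in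 Q^{(2)}\}$. A biclique partition of $G$ is a set $\varepsilon=\{Q_1,\ldots,Q_r\}$ of bicliques in $G$ (subdigraphs of $G$) such that each edge of $G$ belongs to exactly one biclique of $\varepsilon$. $\Theta(\varepsilon)$ is the weighted digraph with vertex set $\{Q_1,\ldots,Q_r\}$ and edge set $\{Q_iQ_j:Q_i^{(2)}\cap Q_j^{(1)}\neq\emptyset\}$, where the edge $Q_iQ_j$ has weight $$w_{Q_iQ_j}(\Theta(\varepsilon))=|Q_j^{(2)}|\sum_{u\in Q_i^{(2)}\cap Q_j^{(1)}}\frac{1}{d_u^+(G)}.$$ *)

(* Defs.v *)
From mathcomp Require Import all_boot all_order all_algebra.
Set Implicit Arguments.
Unset Strict Implicit.
Unset Printing Implicit Defensive.
Import Order.TTheory GRing.Theory Num.Theory.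
Local Open Scope ring_scope.

(* A digraph on the finite vertex type V is given by its edge set; the pair
   (i, j) is the edge with tail i and head j. *)
Notation digraph V := {set V * V}.

Definition outdeg (V : finType) (G : digraph V) (u : V) : nat :=
  #|[set v | (u, v) \in G]|.

Definition undirected (V : finType) (T : digraph V) : rel V :=
  [rel x y | ((x, y) \in T) || ((y, x) \in T)].

Definition connected (V : finType) (T : digraph V) : bool :=
  [forall x, forall y, connect (undirected T) x y].

(* No undirected cycle: the first conjunct excludes loops and pairs of
   antiparallel edges (cycles of length 1 and 2), the second excludes simple
   cycles of length at least 3; such a cycle has at most #|V| vertices, so the
   quantification over tuples is exhaustive, see acyclicP. *)
Definition acyclic (V : finType) (T : digraph V) : bool :=
  [forall x, forall y, ((x, y) \in T) ==> ((y, x) \notin T)] &&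
  [forall n : 'I_#|V|.+1, forall c : n.-tuple V,
     ucycleb (undirected T) c ==> (n <= 2)%N].

Lemma acyclicP (V : finType) (T : digraph V) :
  reflect ((forall x y, (x, y) \in T -> (y, x) \notin T) /\
           (forall c : seq V, ucycle (undirected T) c -> (size c <= 2)%N))
          (acyclic T).
Proof.
apply: (iffP andP) => -[asymT cycT]; split.
- by move=> x y; move/forallP/(_ x)/forallP/(_ y)/implyP: asymT; apply.
- move=> c cyc_c.
  have lt_c : (size c < #|V|.+1)%N.
    by case/andP: (cyc_c) => _ /card_uniqP <-; rewrite ltnS max_card.
  have /forallP/(_ (in_tuple c))/implyP := forallP cycT (Ordinal lt_c).
  exact.
- by apply/forallP => x; apply/forallP => y; apply/implyP; apply: asymT.
apply/forallP => n; apply/forallP => c; apply/implyP => /cycT.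
by rewrite size_tuple.
Qed.

Definition is_tree (V : finType) (T : digraph V) : bool :=
  connected T && acyclic T.

(* A spanning subdigraph is determined by its edge set T. *)
Definition oriented_spanning_trees (V : finType) (G : digraph V) (u : V) :
    {set digraph V} :=
  [set T : digraph V | [&& T \subset G, is_tree T, outdeg T u == 0%N
     & [forall v, (v != u) ==> (outdeg T v == 1%N)]]].

Definition kappa (V : finType) (G : digraph V) (u : V) : nat :=
  #|oriented_spanning_trees G u|.

(* The values of wweight outside of wedges are irrelevant. *)
Record wdigraph (V : finType) := WDigraph {
  wedges : digraph V;
  wweight : V * V -> rat
}.

Definition tree_weight (V : finType) (W : wdigraph V) (u : V) : rat :=
  \sum_(T in oriented_spanning_trees (wedges W) u) \prod_(e in T) wweight W e.

(* A biclique Q is given by its parts Q.1 (tails) and Q.2 (heads). Both parts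
   being nonempty, they are determined by the edges of Q. *)
Notation parts V := ({set V} * {set V})%type.

Definition biclique_edges (V : finType) (Q : parts V) : digraph V :=
  setX Q.1 Q.2.

Definition biclique_in (V : finType) (G : digraph V) (Q : parts V) : Prop :=
  [/\ Q.1 != set0, Q.2 != set0, [disjoint Q.1 & Q.2]
    & biclique_edges Q \subset G].

Definition biclique_partition (V : finType) (G : digraph V)
    (eps : {set parts V}) : Prop :=
  (forall Q, Q \in eps -> biclique_in G Q) /\
  (forall e, e \in G -> exists! Q, Q \in eps /\ e \in biclique_edges Q).

Notation members eps := {Q | Q \in eps}.

Definition Theta (V : finType) (G : digraph V) (eps : {set parts V}) :
    wdigraph (members eps) :=
  WDigraph
    [set e : members eps * members eps |
       (val e.1).2 :&: (val e.2).1 != set0]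
    (fun e => #|(val e.2).2|%:R *
       \sum_(u in (val e.1).2 :&: (val e.2).1) (outdeg G u)%:R^-1).

(* Main.v *)
Require Import Defs.
From mathcomp Require Import all_boot all_order all_fingroup all_algebra ring.
Set Implicit Arguments.
Unset Strict Implicit.
Unset Printing Implicit Defensive.
Import Order.TTheory GRing.Theory Num.Theory.
Local Open Scope ring_scope.

(** Normalize both Laplacians to be of the form "1 - stochastic". With
    P u Q = [u \in Q.1] |Q.2| / d_u and Y Q v = [v \in Q.2] / |Q.2|, they become
    1 - P Y (for G) and 1 - Y P (for Theta): a step of the random walk on G is a
    uniform choice of an edge, made by choosing its biclique first and its head
    next, and the walk on Theta is the same alternating process observed at the
    bicliques. By the matrix-tree theorem all entries of a column of the adjugate
    of such a matrix are the weight of the trees rooted at that column's vertex,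
    and both identities are read off adj(1 - P Y) P = P adj(1 - Y P), the second
    directly and the first with the roles of P and Y exchanged. *)

(** * Delta sums, determinants and adjugates *)

Lemma sumr_deltal (M : nmodType) (I : finType) (F : I -> M) i :
  \sum_j F j *+ (i == j) = F i.
Proof.
rewrite (bigD1 i) //= eqxx big1 ?addr0 // => j; rewrite eq_sym.
by move=> /negPf ->; rewrite mulr0n.
Qed.

Lemma sumr_deltar (M : nmodType) (I : finType) (F : I -> M) i :
  \sum_j F j *+ (j == i) = F i.
Proof. by under eq_bigr do rewrite eq_sym; apply: sumr_deltal. Qed.

(** Both sides are the determinant of the block matrix with diagonal blocks 1 and off-diagonal
    blocks [A] and [B], factored in two ways into block triangular matrices. *)
Lemma det_1subMC (R : comPzRingType) m n (A : 'M[R]_(m, n)) (B : 'M_(n, m)) :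
  \det (1%:M - A *m B) = \det (1%:M - B *m A).
Proof.
have eq1 : block_mx 1%:M A B 1%:M =
    block_mx 1%:M 0 B 1%:M *m block_mx 1%:M A 0 (1%:M - B *m A).
  by rewrite mulmx_block !mul1mx !mul0mx !mulmx1 !addr0 addrC subrK.
have eq2 : block_mx 1%:M A B 1%:M =
    block_mx 1%:M A 0 1%:M *m block_mx (1%:M - A *m B) 0 B 1%:M.
  by rewrite mulmx_block !mul1mx !mul0mx !mulmx1 !add0r subrK.
have := congr1 determinant eq1; rewrite {1}eq2 !det_mulmx.
by rewrite !det_ublock !det_lblock !det1 !mul1r mulr1.
Qed.

(** Multiplied by the common determinant, both sides become [\adj M *m M *m A *m \adj N]. *)
Lemma adj_intertwine (R : idomainType) m n (M : 'M[R]_m) (N : 'M_n)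
    (A : 'M_(m, n)) :
  \det M = \det N -> \det M != 0 -> M *m A = A *m N ->
  \adj M *m A = A *m \adj N.
Proof.
move=> eq_det detM eqMA.
have eqd : \det M *: (\adj M *m A) = \det M *: (A *m \adj N).
  rewrite {1}eq_det -mul_mx_scalar -mul_mx_adj -mulmxA (mulmxA A) -eqMA.
  by rewrite !mulmxA mul_adj_mx -mulmxA mul_scalar_mx.
apply/matrixP => i j; have /matrixP/(_ i j) := eqd.
by rewrite !mxE => /(mulfI detM).
Qed.

(* Replacing A by 'X A makes the two (equal) determinants nonzero polynomials,
   so that they can be cancelled before specializing 'X to 1. *)
Lemma adj_1subMC (R : idomainType) m n (A : 'M[R]_(m, n)) (B : 'M_(n, m)) :
  \adj (1%:M - A *m B) *m A = A *m \adj (1%:M - B *m A).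
Proof.
pose Ax := 'X *: map_mx polyC A; pose Bx := map_mx polyC B.
pose M := 1%:M - Ax *m Bx; pose N := 1%:M - Bx *m Ax.
have ev1 k l (C : 'M[R]_(k, l)) :
    map_mx (horner_eval 1) (map_mx polyC C) = C.
  by apply/matrixP => i j; rewrite !mxE /horner_eval hornerC.
have evA c : map_mx (horner_eval c) Ax = c *: A.
  by apply/matrixP => i j; rewrite !mxE /horner_eval hornerM hornerX hornerC.
have evB c : map_mx (horner_eval c) Bx = B.
  by apply/matrixP => i j; rewrite !mxE /horner_eval hornerC.
have evM c : map_mx (horner_eval c) M = 1%:M - c *: (A *m B).
  by rewrite map_mxB map_mxM map_mx1 evA evB scalemxAl.
have evN c : map_mx (horner_eval c) N = 1%:M - c *: (B *m A).
  by rewrite map_mxB map_mxM map_mx1 evA evB scalemxAr.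
have detM : \det M != 0.
  apply/eqP => /(congr1 (horner_eval 0)).
  rewrite -det_map_mx evM scale0r subr0 det1 rmorph0.
  by apply/eqP; rewrite oner_eq0.
have Px : \adj M *m Ax = Ax *m \adj N.
  apply: adj_intertwine detM _; first exact: det_1subMC.
  by rewrite /M /N mulmxBl mulmxBr mul1mx mulmx1 mulmxA.
have := congr1 (map_mx (horner_eval 1)) Px.
by rewrite !map_mxM !map_mx_adj evM evN evA !scale1r.
Qed.

Lemma det_eq0_ker (R : idomainType) n (A : 'M[R]_n) (x : 'cV_n) i :
  A *m x = 0 -> x i 0 != 0 -> \det A = 0.
Proof.
move=> Ax0 xi; have := mul_adj_mx A => /(congr1 (mulmx^~ x)).
rewrite -mulmxA Ax0 mulmx0 mul_scalar_mx => /matrixP/(_ i 0).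
by rewrite !mxE => /esym/eqP; rewrite mulf_eq0 (negPf xi) orbF => /eqP.
Qed.

Definition set_row (R : Type) n (A : 'M[R]_n) (i0 : 'I_n) (x : 'I_n -> R) :=
  \matrix_(i, j) (if i == i0 then x j else A i j).

(** Cofactors along row [i0] ignore the entries of that row, so combinations of entries in column
    [i0] of the adjugate are determinants. *)
Lemma det_set_row (R : comPzRingType) n (A : 'M[R]_n) i0 (x : 'I_n -> R) :
  \det (set_row A i0 x) = \sum_j x j * \adj A j i0.
Proof.
rewrite (expand_det_row _ i0); apply: eq_bigr => j _.
rewrite !mxE eqxx /cofactor; congr (_ * (_ * \det _)).
by apply/matrixP => k l; rewrite !mxE eq_sym (negPf (neq_lift _ _)).
Qed.

(* When the rows of A sum to zero, replacing a row by a difference of two unit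
   vectors leaves the all-ones vector in the kernel. *)
Lemma adj_zero_row_sum (R : idomainType) n (A : 'M[R]_n) i j k :
  (forall i, \sum_j A i j = 0) -> \adj A i k = \adj A j k.
Proof.
move=> A0; pose x l : R := (l == i)%:R - (l == j)%:R.
have sumx (F : 'I_n -> R) : \sum_l x l * F l = F i - F j.
  rewrite /x; under eq_bigr do rewrite mulrBl !mulr_natl.
  by rewrite sumrB !sumr_deltar.
apply/eqP; rewrite -subr_eq0 -(sumx (fun l => \adj A l k)) -det_set_row.
apply/eqP/(@det_eq0_ker _ _ _ (const_mx 1) k); last by rewrite mxE oner_eq0.
apply/matrixP => l m; rewrite !mxE; under eq_bigr do rewrite !mxE mulr1.
case: eqP => _; last exact: A0.
transitivity (\sum_p x p * 1); last by rewrite (sumx (fun=> 1)) subrr.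
by apply: eq_bigr => p _; rewrite mulr1.
Qed.

(** * Matrices indexed by finite types *)

Definition fun_mx (R : Type) (I J : finType) (g : I -> J -> R) :
    'M[R]_(#|I|, #|J|) :=
  \matrix_(i, j) g (enum_val i) (enum_val j).

Lemma big_enum_valT (R : Type) (idx : R) (op : Monoid.com_law idx)
    (I : finType) (F : I -> R) :
  \big[op/idx]_(i < #|I|) F (enum_val i) = \big[op/idx]_i F i.
Proof. by rewrite (reindex _ (onW_bij _ (enum_val_bij I))). Qed.

Lemma fun_mxM (R : pzRingType) (I J K : finType) (g : I -> J -> R)
    (h : J -> K -> R) :
  fun_mx g *m fun_mx h = fun_mx (fun i k => \sum_j g i j * h j k).
Proof.
apply/matrixP => i k; rewrite !mxE.
rewrite -(big_enum_valT _ (fun j => g (enum_val i) j * h j (enum_val k))).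
by apply: eq_bigr => j _; rewrite !mxE.
Qed.

(** * The matrix-tree theorem for parent functions *)

(** Tree condition for the edges from v to [f v], v different from [u]: an orbit can be cut at its
    first visit to [u], so only values off [u] matter. *)
Definition reaches (V : finType) (f : V -> V) (u : V) : bool :=
  [forall v, fconnect f v u].

Lemma fconnect_neq (V : finType) (f : V -> V) u v :
  v != u -> fconnect f v u = fconnect f (f v) u.
Proof.
move=> neq; apply/idP/idP; last by apply: connect_trans (fconnect1 f v).
move=> vu; rewrite -(iter_findex vu) fconnect_findex 1?eq_sym //.
by rewrite iterSr fconnect_iter.
Qed.

(* In the Leibniz formula only the identity survives: if f reaches u, then any
   other permutation s has s v = f v for all v in the orbit of some moved point,
   up to u, although u is fixed by s. *)
Lemma det_reaches (R : idomainType) (V : finType) (f : V -> V) (u : V) :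
  \det (fun_mx (fun v w : V =>
      (v == w)%:R - ((v != u) && (f v == w))%:R : R)) = (reaches f u)%:R.
Proof.
set A := fun_mx _; case: (boolP (reaches f u)) => [/forallP reach|].
  rewrite /determinant (bigD1 1%g) //= [X in _ + X]big1 ?addr0.
    (* The identity contributes 1: a fixed point of [f] other than [u] would never reach [u]. *)
    rewrite odd_perm1 mul1r big1 // => i _; rewrite perm1 mxE eqxx.
    case: (altP (enum_val i =P u)) => [|neq]; rewrite ?subr0 //=.
    case: eqP => [fv|]; rewrite ?subr0 //.
    have := fconnect_findex (reach (enum_val i)); rewrite eq_sym fv => /(_ neq).
    by move/n_Sn.
  move=> s s1; pose t v := enum_val (s (enum_rank v)).
  have t_inj : injective t.
    by move=> v w /enum_val_inj/perm_inj/enum_rank_inj.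
  have [t_ok|] := boolP [forall v, (t v == v) || (v != u) && (f v == t v)].
    have neqt v : t v != v -> (v != u) && (f v == t v).
      by move=> /negPf tv; have := forallP t_ok v; rewrite tv.
    have moved v k : t v != v -> t (iter k f v) != iter k f v.
      move=> tv; elim: k => // k IH /=.
      by have /andP[_ /eqP ->] := neqt _ IH; rewrite (inj_eq t_inj).
    case/negP: s1; apply/eqP/permP => i; rewrite perm1; apply/eqP.
    apply: contraT => si; have tv : t (enum_val i) != enum_val i.
      by rewrite /t enum_valK (inj_eq enum_val_inj).
    have := moved _ (findex f (enum_val i) u) tv.
    by rewrite (iter_findex (reach _)) => /neqt; rewrite eqxx.
  rewrite negb_forall => /existsP[v]; rewrite negb_or => /andP[tv fv].
  rewrite (bigD1 (enum_rank v)) //= mxE enum_rankK -/(t v) eq_sym (negPf tv).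
  by rewrite (negPf fv) subr0 mul0r mulr0.
rewrite negb_forall => /existsP[v nvu].
(* The indicator of the vertices that do not reach [u] lies in the kernel: it vanishes at [u] and is
   unchanged by a step of [f] from any other vertex. *)
pose x : 'cV[R]_#|V| := \col_i (~~ fconnect f (enum_val i) u)%:R.
apply: (@det_eq0_ker _ _ _ x (enum_rank v)); last first.
  by rewrite mxE enum_rankK nvu oner_eq0.
apply/matrixP => i j; rewrite !mxE; set w := enum_val i.
under eq_bigr do rewrite !mxE.
rewrite (big_enum_valT _ (fun z => ((w == z)%:R - ((w != u) && (f w == z))%:R)
  * (~~ fconnect f z u)%:R)).
under eq_bigr do rewrite mulrBl !mulr_natl.
rewrite sumrB sumr_deltal; have [->|neq] := altP (w =P u).
  by rewrite big1 ?subr0 ?connect0 // => z _; rewrite mulr0n.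
by rewrite /= sumr_deltal (fconnect_neq f neq) subrr.
Qed.

(** Multilinearity in all rows at once: [f] chooses one summand in each row. *)
Lemma det_row_combination (R : comPzRingType) (V W : finType) (c : V -> W -> R)
    (g : V -> W -> V -> R) :
  \det (fun_mx (fun v w => \sum_z c v z * g v z w)) =
  \sum_(f : {ffun V -> W})
     (\prod_v c v (f v)) * \det (fun_mx (fun v => g v (f v))).
Proof.
rewrite /determinant; under [RHS]eq_bigr do rewrite mulr_sumr.
rewrite exchange_big; apply: eq_bigr => s _.
under [RHS]eq_bigr do rewrite mulrCA.
rewrite -mulr_sumr; congr (_ * _).
pose t v := enum_val (s (enum_rank v)).
transitivity (\prod_v \sum_z c v z * g v z (t v)).
  rewrite -(big_enum_valT _ (fun v => \sum_z c v z * g v z (t v))).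
  by apply: eq_bigr => i _; rewrite mxE /t enum_valK.
rewrite bigA_distr_bigA; apply: eq_bigr => f _.
rewrite big_split; congr (_ * _).
rewrite -(big_enum_valT _ (fun v => g v (f v) (t v))).
by apply: eq_bigr => i _; rewrite mxE /t enum_valK.
Qed.

(** Weighted count of the trees rooted at [u], encoded by parent functions; fixing [f u] makes each
    tree count once. *)
Definition tree_sum (R : comPzRingType) (V : finType) (a : V -> V -> R) (u : V)
    : R :=
  \sum_(f : {ffun V -> V} | (f u == u) && reaches f u)
     \prod_(v | v != u) a v (f v).

Definition laplacian (R : comPzRingType) (V : finType) (a : V -> V -> R)
    (v w : V) : R :=
  (\sum_z a v z) *+ (v == w) - a v w.

(** Zero row sums reduce the entry to the diagonal one, a determinant whose row [u] is a unit
    vector. Expanding the other rows over the choice of a parent leaves the determinants of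
    [det_reaches]. *)
Theorem matrix_tree (R : idomainType) (V : finType) (a : V -> V -> R)
    i (u : V) :
  \adj (fun_mx (laplacian a)) i (enum_rank u) = tree_sum a u.
Proof.
set A := fun_mx _; set k := enum_rank u.
have A0 l : \sum_j A l j = 0.
  under eq_bigr do rewrite mxE.
  rewrite (big_enum_valT _ (laplacian a (enum_val l))) sumrB.
  by rewrite sumr_deltal subrr.
rewrite (adj_zero_row_sum _ k _ A0).
pose x (j : 'I_#|V|) : R := (j == k)%:R.
have -> : \adj A k k = \det (set_row A k x).
  rewrite det_set_row; under eq_bigr do rewrite /x mulr_natl.
  by rewrite sumr_deltar.
(* Row v of the Laplacian is the combination of the differences e_v - e_z with coefficients [a v z].
   In row [u] the coefficients force the choice z = [u], whence the condition [f u == u]. *)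
pose c v z : R := if v == u then (z == u)%:R else a v z.
pose g v z w : R := (v == w)%:R - ((v != u) && (z == w))%:R.
have -> : set_row A k x = fun_mx (fun v w => \sum_z c v z * g v z w).
  apply/matrixP => l j; rewrite !mxE -(inj_eq enum_val_inj) enum_rankK /c /g.
  case: eqP => [->|_] /=.
    under eq_bigr do rewrite mulr_natl subr0.
    rewrite sumr_deltar /x eq_sym.
    by rewrite -(inj_eq enum_val_inj) enum_rankK.
  under eq_bigr do rewrite mulrBr !mulr_natr /=.
  by rewrite sumrB sumr_deltar /laplacian -sumrMnl.
rewrite det_row_combination /tree_sum [RHS]big_mkcond; apply: eq_bigr => f _.
rewrite det_reaches (bigD1 u) //= {1}/c eqxx.
rewrite (eq_bigr (fun v => a v (f v))) => [|v /negPf nvu]; last first.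
  by rewrite /c nvu.
case: (f u == u) (reaches f u) => [] [] /=;
  by rewrite ?mul0r ?mulr1 ?mulr0 ?mul1r.
Qed.

Lemma tree_sum_scale (F : fieldType) (V : finType) (a : V -> V -> F)
    (c : V -> F) u :
  tree_sum (fun v w => a v w / c v) u = tree_sum a u / \prod_(v | v != u) c v.
Proof.
rewrite /tree_sum mulr_suml; apply: eq_bigr => f _.
by rewrite big_split /= prodfV.
Qed.

(** * Oriented spanning trees as parent functions *)

Definition parent_edges (V : finType) (u : V) (f : V -> V) : digraph V :=
  [set (v, f v) | v in [set~ u]].

Lemma mem_parent_edges (V : finType) (u : V) f v w :
  ((v, w) \in parent_edges u f) = (v != u) && (w == f v).
Proof.
apply/imsetP/andP => [[x xu [-> ->]]|[vu /eqP ->]]; last first.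
  by exists v; rewrite ?inE.
by move: xu; rewrite !inE.
Qed.

Lemma parent_edges_sub (V : finType) (G : digraph V) (u : V) f :
  (parent_edges u f \subset G) = [forall v, (v != u) ==> ((v, f v) \in G)].
Proof.
apply/subsetP/forallP => [sub v|sub [v w]].
  by apply/implyP => vu; apply: sub; rewrite mem_parent_edges vu eqxx.
rewrite mem_parent_edges => /andP[vu /eqP ->].
exact: implyP (sub v) vu.
Qed.

Lemma outdeg_parent_edges (V : finType) (u : V) f v :
  outdeg (parent_edges u f) v = (v != u).
Proof.
rewrite /outdeg; case: (altP (v =P u)) => [->|vu].
  apply/eqP; rewrite cards_eq0 -subset0; apply/subsetP => w.
  by rewrite inE mem_parent_edges eqxx.
rewrite -[RHS](cards1 (f v)); congr #|pred_of_set _|.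
by apply/setP => w; rewrite !inE mem_parent_edges vu.
Qed.

Lemma undirected_sym (V : finType) (T : digraph V) : symmetric (undirected T).
Proof. by move=> x y; exact: orbC. Qed.

Lemma connected_parent_edges (V : finType) (u : V) f :
  connected (parent_edges u f) = reaches f u.
Proof.
set T := parent_edges u f.
apply/forallP/forallP => [con v|reach v].
  have /connectP[p up ->] := forallP (con u) v.
  (* On an undirected path from [u], each vertex is the parent or a child of the previous one, and
     either way inherits that it reaches [u]. *)
  elim/last_ind: p up => [|p w IH]; first by rewrite connect0.
  rewrite rcons_path last_rcons => /andP[/IH]; set x := last u p => xu.
  rewrite /undirected /= !mem_parent_edges => /orP[]/andP[neq /eqP eqf].
    by rewrite eqf -fconnect_neq.
  by rewrite fconnect_neq // -eqf.
have toroot w : connect (undirected T) w u.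
  have [n] := ubnP (findex f w u); elim: n w => // n IH w lt_n.
  have [->|wu] := eqVneq w u; first exact: connect0.
  apply: (@connect_trans _ _ (f w)); last first.
    by apply: IH; rewrite fconnect_findex 1?eq_sym // in lt_n.
  by apply: connect1; rewrite /undirected /= mem_parent_edges wu eqxx.
apply/forallP => w; apply: connect_trans (toroot v) _.
by rewrite (sym_connect_sym (undirected_sym T)).
Qed.

(* A vertex of a cycle at maximal distance from u has both its neighbours on
   the cycle equal to its parent. *)
Lemma acyclic_parent_edges (V : finType) (u : V) f :
  reaches f u -> acyclic (parent_edges u f).
Proof.
move=> /forallP reach; pose h v := findex f v u.
have h_parent v : v != u -> h v = (h (f v)).+1.
  by move=> vu; apply: fconnect_findex; rewrite 1?eq_sym.
apply/acyclicP; split=> [x y|c].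
  rewrite !mem_parent_edges => /andP[xu /eqP ->].
  apply/negP => /andP[fxu /eqP xE].
  have := h_parent _ xu; rewrite (h_parent _ fxu) -xE => /eqP.
  by rewrite -addn2 -{1}[h x]addn0 eqn_add2l.
case: c => // x0 c /andP[cyc uniq_c].
set s := x0 :: c in cyc uniq_c *.
have x0s : x0 \in s by rewrite mem_head.
case: (@arg_maxnP _ x0 (mem s) h x0s) => x xs max_x.
have is_parent y : y \in s -> undirected (parent_edges u f) x y -> y = f x.
  move=> ys; rewrite /undirected /= !mem_parent_edges.
  move=> /orP[]/andP[neq /eqP eqf] //.
  by have := max_x y ys; rewrite (h_parent y neq) -eqf /= ltnn.
have nx : next s x = f x.
  by apply: is_parent; rewrite ?mem_next // next_cycle.
have px : prev s x = f x.
  by apply: is_parent; rewrite ?mem_prev // undirected_sym prev_cycle.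
have nn : next s (next s x) = x by rewrite {1}nx -px next_prev.
(* With [x] rotated to the front, the third vertex of a longer cycle would be [next s (next s x)],
   that is [x], against uniqueness. *)
have [i r rotE] := rot_to xs.
have uniq_r : uniq (x :: r) by rewrite -rotE rot_uniq.
have next_r : next s =1 next (x :: r).
  by move=> y; rewrite -rotE next_rot.
rewrite -(size_rot i s) rotE; move: nn uniq_r; rewrite !next_r.
case: r {rotE next_r} => [|y [|z r]] //=; rewrite eqxx.
have [->|yx] := eqVneq x y; first by rewrite inE eqxx.
by rewrite eqxx => ->; rewrite !inE eqxx !orbT.
Qed.

Lemma mem_oriented_spanning_trees (V : finType) (G : digraph V) u f :
  (parent_edges u f \in oriented_spanning_trees G u) =
  [forall v, (v != u) ==> ((v, f v) \in G)] && reaches f u.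
Proof.
rewrite inE parent_edges_sub /is_tree connected_parent_edges.
congr (_ && _); case: (boolP (reaches f u)) => // reach.
rewrite acyclic_parent_edges // outdeg_parent_edges eqxx /=.
by apply/forallP => v; rewrite outdeg_parent_edges; apply/implyP => ->.
Qed.

(** Inverse of [parent_edges] on trees rooted at [u], where [pick] finds the unique out-neighbour;
    the root is sent to itself as in [tree_sum]. *)
Definition parent (V : finType) (u : V) (T : digraph V) : {ffun V -> V} :=
  [ffun v => if v == u then u else odflt u [pick w | (v, w) \in T]].

Lemma parentK (V : finType) (G : digraph V) (u : V) T :
  T \in oriented_spanning_trees G u -> parent_edges u (parent u T) = T.
Proof.
rewrite inE => /and4P[_ _ /eqP deg0 /forallP deg1].
apply/setP => -[v w]; rewrite mem_parent_edges ffunE.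
have [->|vu] := eqVneq v u.
  by apply/esym/negbTE/negP => uw; have := card0_eq deg0 w; rewrite inE uw.
have /cards1P[z zE] := implyP (deg1 v) vu.
have memT y : ((v, y) \in T) = (y == z) by rewrite -in_set1 -zE inE.
rewrite memT; case: pickP => [y|/(_ z)]; rewrite memT ?eqxx // => /eqP ->.
by [].
Qed.

Lemma parent_edgesK (V : finType) (u : V) (f : {ffun V -> V}) :
  (parent u (parent_edges u f) == f) = (f u == u).
Proof.
apply/eqP/eqP => [<-|fu]; first by rewrite ffunE eqxx.
apply/ffunP => v; rewrite ffunE; have [->//|vu] := eqVneq v u.
case: pickP => [w|/(_ (f v))]; rewrite mem_parent_edges vu ?eqxx //=.
by move/eqP.
Qed.

(** Extension by zero: parent functions that use a non-edge contribute nothing to [tree_sum]. *)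
Definition arc_weight (V : finType) (W : wdigraph V) (v w : V) : rat :=
  if (v, w) \in wedges W then wweight W (v, w) else 0.

Lemma tree_weightE (V : finType) (W : wdigraph V) u :
  tree_weight W u = tree_sum (arc_weight W) u.
Proof.
rewrite /tree_weight /tree_sum.
rewrite (reindex_onto (fun f : {ffun V -> V} => parent_edges u f) (parent u));
  last exact: parentK.
rewrite big_mkcond [RHS]big_mkcond; apply: eq_bigr => f _.
rewrite mem_oriented_spanning_trees parent_edgesK andbAC -andbA.
case: (_ && reaches f u); rewrite ?andbF //= ?andbT.
case: (boolP [forall v, _]) => [/forallP sub|].
  rewrite big_imset => [|v w _ _ [] //].
  apply: eq_big => v; rewrite !inE // => vu.
  by rewrite /arc_weight (implyP (sub v) vu).
rewrite negb_forall => /existsP[v]; rewrite negb_imply => /andP[vu nG].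
by rewrite (bigD1 v) //= /arc_weight (negPf nG) mul0r.
Qed.

Lemma kappaE (V : finType) (G : digraph V) u :
  (kappa G u)%:R = tree_sum (fun v w => ((v, w) \in G)%:R) u :> rat.
Proof.
transitivity (tree_weight (WDigraph G (fun=> 1)) u).
  rewrite /tree_weight /kappa -sum1_card natr_sum.
  by apply: eq_bigr => T _; rewrite big1.
rewrite tree_weightE; apply: eq_bigr => f _; apply: eq_bigr => v _.
by rewrite /arc_weight /=; case: (_ \in _).
Qed.

(** * Tree sums of products of stochastic kernels *)

Lemma laplacian_stochastic (R : comPzRingType) (V : finType) (a : V -> V -> R) :
  (forall v, \sum_w a v w = 1) -> fun_mx (laplacian a) = 1%:M - fun_mx a.
Proof.
move=> a1; apply/matrixP => i j.
by rewrite !mxE /laplacian a1 (inj_eq enum_val_inj).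
Qed.

Lemma sum_mul_stochastic (R : pzRingType) (V W U : finType) (p : V -> W -> R)
    (q : W -> U -> R) :
  (forall v, \sum_w p v w = 1) -> (forall w, \sum_u q w u = 1) ->
  forall v, \sum_u \sum_w p v w * q w u = 1.
Proof.
move=> p1 q1 v; rewrite exchange_big -[RHS](p1 v); apply: eq_bigr => w _.
by rewrite -mulr_sumr q1 mulr1.
Qed.

(** Entry ([v0], [w]) of the identity [adj_1subMC], with adjugate entries replaced by tree sums; on
    one side the tree sum at [w] factors out and row [v0] of [p] sums to 1. *)
Lemma tree_sum_intertwine (R : idomainType) (V W : finType) (p : V -> W -> R)
    (q : W -> V -> R) (v0 : V) (w : W) :
  (forall v, \sum_w p v w = 1) -> (forall w, \sum_v q w v = 1) ->
  tree_sum (fun w w' => \sum_v q w v * p v w') w =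
  \sum_v tree_sum (fun v v' => \sum_w p v w * q w v') v * p v w.
Proof.
move=> p1 q1; have := adj_1subMC (fun_mx p) (fun_mx q).
rewrite !fun_mxM -!laplacian_stochastic; try exact: sum_mul_stochastic.
move/matrixP/(_ (enum_rank v0) (enum_rank w)); rewrite !mxE => eq_vw.
pose Lpq := \adj (fun_mx (laplacian (fun v v' => \sum_w p v w * q w v'))).
transitivity (\sum_j fun_mx p (enum_rank v0) j *
   tree_sum (fun w w' => \sum_v q w v * p v w') w).
  rewrite -mulr_suml -[LHS]mul1r -(p1 v0) -(big_enum_valT _ (p v0)).
  by congr (_ * _); apply: eq_bigr => j _; rewrite mxE enum_rankK.
transitivity (\sum_j Lpq (enum_rank v0) j * fun_mx p j (enum_rank w)).
  by rewrite eq_vw; apply: eq_bigr => j _; rewrite matrix_tree.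
rewrite -(big_enum_valT _ (fun v => tree_sum _ v * p v w)).
apply: eq_bigr => j _; rewrite [fun_mx p _ _]mxE enum_rankK; congr (_ * _).
by rewrite -[in LHS](enum_valK j); exact: matrix_tree.
Qed.

Lemma eq_tree_sum (R : comPzRingType) (V : finType) (a b : V -> V -> R) :
  a =2 b -> tree_sum a =1 tree_sum b.
Proof. by move=> eqab u; apply: eq_bigr => f _; apply: eq_bigr. Qed.

Lemma mulr_divD1 (F : fieldType) (I : finType) (c : I -> F) i (x : F) :
  c i != 0 -> x / \prod_(j | j != i) c j = x * c i / \prod_j c j.
Proof.
by move=> ci; rewrite [in RHS](bigD1 i) //= invfM mulrA mulfK.
Qed.

Lemma big_members (R : Type) (idx : R) (op : Monoid.com_law idx) (T : finType)
    (A : {set T}) (F : T -> R) :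
  \big[op/idx]_(x in A) F x = \big[op/idx]_(x : {x | x \in A}) F (val x).
Proof.
rewrite (reindex_omap (val : {x | x \in A} -> T) insub); last first.
  by move=> x xA; rewrite insubT.
by apply: eq_bigl => x; rewrite valK eqxx andbT (valP x).
Qed.

(** * The random walk of a biclique partition *)

(** For a biclique partition, the probability that a uniformly chosen out-edge of [u] belongs to
    [Q]. *)
Definition tail_step (V : finType) (G : digraph V) (eps : {set parts V})
    (u : V) (Q : members eps) : rat :=
  (#|(val Q).2| * (u \in (val Q).1))%:R / (outdeg G u)%:R.

Definition head_step (V : finType) (eps : {set parts V}) (Q : members eps)
    (v : V) : rat :=
  (v \in (val Q).2)%:R / #|(val Q).2|%:R.

(** An edge lies in exactly one biclique, and a non-edge in none because bicliques are contained in
    [G]. *)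
Lemma mem_biclique_partition (V : finType) (G : digraph V) (eps : {set parts V})
    (eps_partition : biclique_partition G eps) u v :
  ((u, v) \in G : nat) =
  (\sum_(Q : members eps) (u \in (val Q).1) * (v \in (val Q).2))%N.
Proof.
have [sub ex1] := eps_partition.
have mem (Q : members eps) :
    ((u \in (val Q).1) * (v \in (val Q).2))%N =
    ((u, v) \in biclique_edges (val Q)).
  by rewrite in_setX mulnb.
under eq_bigr do rewrite mem.
have [uvG|uvG] := boolP ((u, v) \in G).
  have [Q [[Qeps uvQ] uniqQ]] := ex1 _ uvG.
  rewrite (bigD1 (exist _ Q Qeps)) //= uvQ big1 // => R neqR.
  apply/eqP; rewrite eqb0; apply: contra neqR => uvR.
  by apply/eqP/val_inj/esym/uniqQ; split=> //; apply: valP.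
rewrite big1 // => Q _; apply/eqP; rewrite eqb0; apply: contra uvG.
by have [_ _ _ /subsetP] := sub _ (valP Q); apply.
Qed.

Lemma outdeg_biclique_partition (V : finType) (G : digraph V)
    (eps : {set parts V}) (eps_partition : biclique_partition G eps) u :
  outdeg G u = (\sum_(Q : members eps) #|(val Q).2| * (u \in (val Q).1))%N.
Proof.
rewrite /outdeg -sum1_card big_mkcond /=.
under eq_bigr => v _.
  rewrite inE -/(nat_of_bool _) (mem_biclique_partition eps_partition); over.
rewrite exchange_big; apply: eq_bigr => Q _.
by rewrite -big_distrr -sum1_card [in RHS]big_mkcond mulnC.
Qed.

Lemma theta_arc_weight (V : finType) (G : digraph V) (eps : {set parts V}) Q R :
  arc_weight (Theta G eps) Q R / #|(val Q).2|%:R =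
  \sum_v head_step Q v * tail_step G v R.
Proof.
rewrite /arc_weight /= inE /=.
(* Off the edge set the intersection is empty, so the weight formula already gives 0. *)
have -> : (if (val Q).2 :&: (val R).1 != set0 then
     #|(val R).2|%:R * \sum_(u in (val Q).2 :&: (val R).1) (outdeg G u)%:R^-1
     else 0) =
   #|(val R).2|%:R *
     \sum_(u in (val Q).2 :&: (val R).1) (outdeg G u)%:R^-1 :> rat.
  by case: eqP => //= ->; rewrite big_set0 mulr0.
rewrite big_mkcond mulr_sumr mulr_suml; apply: eq_bigr => v _.
rewrite /head_step /tail_step inE natrM.
case: (v \in (val Q).2) (v \in (val R).1) => [] [] /=;
  rewrite ?mulr0 ?mul0r ?mulr0 //.
by rewrite mulr1 mul1r mulrC.
Qed.

(** The size of [Q.2] cancels between the two steps. *)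
Lemma edge_tail_head_step (V : finType) (G : digraph V) (eps : {set parts V})
    (eps_partition : biclique_partition G eps) u v :
  ((u, v) \in G)%:R / (outdeg G u)%:R =
  \sum_(Q : members eps) tail_step G u Q * head_step Q v.
Proof.
rewrite (mem_biclique_partition eps_partition) natr_sum mulr_suml.
apply: eq_bigr => Q _; rewrite /tail_step /head_step natrM.
have [_ Q2 _ _] := eps_partition.1 _ (valP Q).
have q0 : #|(val Q).2|%:R != 0 :> rat by rewrite pnatr_eq0 cards_eq0.
rewrite natrM; move: (outdeg G u)%:R^-1 (_ \in (val Q).2)%:R => x y.
by field.
Qed.

Lemma tail_step_sum (V : finType) (G : digraph V) (eps : {set parts V})
    (outdeg_gt0 : forall u : V, (0 < outdeg G u)%N)
    (eps_partition : biclique_partition G eps) u :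
  \sum_(Q : members eps) tail_step G u Q = 1.
Proof.
rewrite -mulr_suml -natr_sum -(outdeg_biclique_partition eps_partition) divff //.
by rewrite pnatr_eq0 -lt0n.
Qed.

Lemma head_step_sum (V : finType) (eps : {set parts V}) (Q : members eps) :
  (val Q).2 != set0 -> \sum_v head_step Q v = 1.
Proof.
move=> Q2; rewrite -mulr_suml -natr_sum -big_mkcond sum1_card divff //.
by rewrite pnatr_eq0 cards_eq0.
Qed.

(** * Deduction of the two identities *)

Theorem theorem3p3 (V : finType) (G : digraph V) (eps : {set parts V})
    (outdeg_gt0 : forall u : V, (0 < outdeg G u)%N)
    (eps_partition : biclique_partition G eps) :
  (forall u : V,
     (kappa G u)%:R =
       (\prod_(v : V | v != u) (outdeg G v)%:R)
         / (\prod_(Q in eps) #|Q.2|%:R)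
       * \sum_(Q : members eps | u \in (val Q).2)
           tree_weight (Theta G eps) Q :> rat)
  /\
  (forall Q : members eps,
     tree_weight (Theta G eps) Q =
       (\prod_(P in eps) #|P.2|%:R)
         / (\prod_(u : V) (outdeg G u)%:R)
       * \sum_(u in (val Q).1) (kappa G u)%:R).
Proof.
pose d v : rat := (outdeg G v)%:R.
pose s (Q : members eps) : rat := #|(val Q).2|%:R.
have d0 v : d v != 0 by rewrite pnatr_eq0 -lt0n.
have Q2 (Q : members eps) : (val Q).2 != set0.
  by have [] := eps_partition.1 _ (valP Q).
have s0 Q : s Q != 0 by rewrite pnatr_eq0 cards_eq0.
have prodd : \prod_v d v != 0 by apply/prodf_neq0.
have prods : \prod_Q s Q != 0 by apply/prodf_neq0.
have tail1 := tail_step_sum outdeg_gt0 eps_partition.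
have head1 Q := head_step_sum (Q2 Q).
(* Normalizing by outdegrees divides by their product over all vertices except the root; the factor
   [d u] completes it to the full product. *)
have kappaM u : tree_sum (fun v w =>
    \sum_(Q : members eps) tail_step G v Q * head_step Q w) u =
    (kappa G u)%:R * d u / \prod_v d v.
  rewrite -mulr_divD1 // kappaE -tree_sum_scale; apply: eq_tree_sum => v w.
  by rewrite -edge_tail_head_step.
have thetaM Q : tree_sum (fun Q R =>
    \sum_v head_step Q v * tail_step G v R) Q =
    tree_weight (Theta G eps) Q * s Q / \prod_Q s Q.
  rewrite -mulr_divD1 // tree_weightE -tree_sum_scale; apply: eq_tree_sum => R P.
  by rewrite -theta_arc_weight.
have prodE : \prod_(Q in eps) #|Q.2|%:R = \prod_Q s Q.
  exact: (big_members _ eps (fun Q => #|Q.2|%:R)).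
split=> [u|Q]; rewrite prodE.
  (* A biclique is needed to select a row in [tree_sum_intertwine]; with none, the tail steps from
     [u] could not sum to 1. *)
  have /existsP[Q0 _] : [exists Q : members eps, true].
    apply: contraT; rewrite negb_exists => /forallP noQ.
    by have := tail1 u; rewrite big1 // => Q; have := noQ Q.
  have := tree_sum_intertwine Q0 u head1 tail1; rewrite kappaM.
  under [in RHS]eq_bigr do rewrite thetaM.
  (* Scaling by [d u / \prod_v d v] produces the left side of [eq_ku]; the factor [s Q] from
     [thetaM] then cancels the denominator of [head_step], and the sums agree termwise. *)
  move=> eq_ku; apply: (mulIf (d0 u)); apply: (mulIf (invr_neq0 prodd)).
  rewrite eq_ku (bigD1 u (P := predT)) //= -/(d u).
  rewrite (big_mkcond (fun Q => u \in _)) mulr_sumr !mulr_suml.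
  apply: eq_bigr => Q _.
  rewrite /head_step -/(s Q); case: (u \in _); last by rewrite !(mul0r, mulr0).
  rewrite mulr1n.
  rewrite -/(\prod_(v | v != u) d v).
  have pd : \prod_(v | v != u) d v != 0 by apply/prodf_neq0.
  by field; apply/and4P; split; [| exact: d0 | | exact: s0].
have [Q1 _ _ _] := eps_partition.1 _ (valP Q).
have [v0 _] := set0Pn _ Q1.
have := tree_sum_intertwine v0 Q tail1 head1; rewrite thetaM.
under [in RHS]eq_bigr do rewrite kappaM.
(* Likewise, after scaling by [s Q / \prod_Q s Q], the factor [d v] from [kappaM] cancels the
   denominator of [tail_step]. *)
move=> eq_tQ; apply: (mulIf (s0 Q)); apply: (mulIf (invr_neq0 prods)).
rewrite eq_tQ [in RHS](big_mkcond (fun v => v \in _)) mulr_sumr.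
rewrite !mulr_suml; apply: eq_bigr => v _.
rewrite /tail_step -/(d v) natrM -/(s Q).
case: (v \in _); last by rewrite !(mul0r, mulr0).
rewrite mulr1n.
rewrite -/(\prod_v d v).
by field; apply/and3P; split=> //; exact: d0.
Qed.
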